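(* Let $X$ be a Hausdorff locally convex topological vector space over $\mathbb{R}$ with continuous dual $X^*$, let $V\subset X$ be compact, let $K\subset\mathbb{R}^d$ be compact, let $m\ge1$, and let $G:V\to C(K;\mathbb{R}^m)$ be continuous, where $C(K;\mathbb{R}^m)$ carries the uniform norm $\|h\|_K=\sup_{y\in K}\|h(y)\|_{\mathbb{R}^m}$. Assume $\sigma\in C(\mathbb{R})$ is a Tauber--Wiener function. Then for every $\varepsilon>0$ there exist an integer $N\ge1$, vectors $\omega_1,\dots,\omega_N\in\mathbb{R}^d$, scalars $\zeta_1,\dots,\zeta_N\in\mathbb{R}$, defining ridge functions $\phi_k(y)=\sigma(\omega_k\cdot y+\zeta_k)$, and single-hidden-layer topological neural networks $a_k:X\to\mathbb{R}^m$, $k=1,\dots,N$, such that \[ \sup_{u\in V}\ \sup_{y\in K}\Bigl\|G(u)(y)-\sum_{k=1}^N a_k(u)\,\phi_k(y)\Bigr\|_{\mathbb{R}^m}<\varepsilon . \]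
   Context: A function $\sigma:\mathbb{R}\to\mathbb{R}$ is a Tauber--Wiener function if the linear span of $\{t\mapsto\sigma(wt-\theta): w,\theta\in\mathbb{R}\}$ is dense in $C([a,b])$ (uniform norm) for every closed interval $[a,b]\subset\mathbb{R}$. A (vector-valued, single-hidden-layer) topological feedforward neural network on $X$ is a map $H:X\to\mathbb{R}^m$ of the form $H(x)=A\,\sigma(T(x))$, where $T(x)=(f_1(x)-\theta_1,\dots,f_r(x)-\theta_r)$ for some $r\ge1$, $f_i\in X^*$, $\theta_i\in\mathbb{R}$, $A\in\mathbb{R}^{m\times r}$, and $\sigma$ acts componentwise on $\mathbb{R}^r$. $\|\cdot\|_{\mathbb{R}^m}$ is any fixed norm on $\mathbb{R}^m$; $\omega\cdot y$ is the Euclidean inner product. *)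

(* Defs.v *)
From HB Require Import structures.
From mathcomp Require Import all_boot all_order all_algebra.
From mathcomp Require Import all_classical all_reals all_analysis.
Set Implicit Arguments. Unset Strict Implicit. Unset Printing Implicit Defensive.
Import Order.TTheory GRing.Theory Num.Theory.
Import numFieldNormedType.Exports.
Local Open Scope classical_set_scope.
Local Open Scope ring_scope.

Definition dotr (R : realType) (d : nat) (w y : 'rV[R]_d) : R :=
  \sum_(i < d) w ord0 i * y ord0 i.

(* A norm on R^m (the statement holds for any fixed norm). *)
Definition is_norm (R : realType) (m : nat) (N : 'rV[R]_m -> R) : Prop :=
  [/\ forall x y, N (x + y) <= N x + N y,
      forall (a : R) x, N (a *: x) = `|a| * N x
    & forall x, N x = 0 -> x = 0].

Definition in_dual (R : realType) (X : tvsType R) (f : X -> R) : Prop :=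
  [/\ forall x y, f (x + y) = f x + f y,
      forall (a : R) x, f (a *: x) = a * f x
    & continuous f].

Definition tauber_wiener (R : realType) (sigma : R -> R) : Prop :=
  forall a b : R, forall g : R -> R, {within `[a, b], continuous g} ->
  forall e : R, 0 < e ->
  exists n : nat, exists c w th : 'I_n -> R,
    forall t, a <= t <= b ->
      `|g t - \sum_(i < n) c i * sigma (w i * t - th i)| < e.

Definition topo_nn (R : realType) (X : tvsType R) (m : nat) (sigma : R -> R)
  (H : X -> 'rV[R]_m) : Prop :=
  exists r : nat, (0 < r)%N /\
  exists (f : 'I_r -> X -> R) (theta : 'I_r -> R) (A : 'M[R]_(m, r)),
    (forall i, in_dual (f i)) /\
    forall x, H x = \row_(j < m) \sum_(i < r) A j i * sigma (f i x - theta i).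

(* Main.v *)
Require Import Defs.
From HB Require Import structures.
From mathcomp Require Import all_boot all_order all_algebra.
From mathcomp Require Import all_classical all_reals all_analysis.
From mathcomp Require Import ring lra.
Import Order.TTheory GRing.Theory Num.Theory.
Import numFieldNormedType.Exports.
Local Open Scope classical_set_scope.
Local Open Scope ring_scope.

(* Write F(u, y) = G(u)(y), a continuous function on the compact set V x K. The functions
   exp(f(u) + w . y), with f in the dual of X and w in R^d, span a subalgebra of C(V x K)
   which separates points, because by Hahn-Banach (applied to the gauge of a convex
   neighbourhood of 0) the dual separates the points of X. By Stone-Weierstrass each
   coordinate of F is a uniform limit of such exponential sums. Each exponential factors as
   exp(f(u)) exp(w . y), and since f(V) and w . K are bounded, the Tauber-Wiener property
   replaces the one-variable function exp in each factor by a combination of dilates and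
   translates of sigma. This leaves sums of products sigma(f(u) - theta) sigma(w . y + zeta). *)

Set Implicit Arguments. Unset Strict Implicit.

(** * Hahn-Banach theorem for sublinear functionals *)

Section HahnBanach.
Context {R : realType} {X : lmodType R}.
Implicit Types (p q : X -> R) (x y : X).

(** Homogeneity is asked as an inequality for t > 0 only, which is easy to check for infima; applied
    to t and to its inverse it gives equality. *)
Definition sublinear p :=
  (forall x y, p (x + y) <= p x + p y) /\
  (forall (t : R) x, 0 < t -> p (t *: x) <= t * p x).

Lemma sublinearZ p : sublinear p ->
  forall (t : R) x, 0 <= t -> p (t *: x) = t * p x.
Proof.
move=> [_ pZ].
have pos t x : 0 < t -> p (t *: x) = t * p x.
  move=> t0; apply/eqP; rewrite eq_le pZ//= -ler_pdivlMl//.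
  rewrite -[in leLHS](scale1r x) -(mulVf (lt0r_neq0 t0)) -scalerA.
  by rewrite pZ// invr_gt0.
move=> t x; rewrite le_eqVlt => /predU1P[<-|/pos//].
have := pos 2 0 (ltr0n _ _); rewrite scaler0 scale0r mul0r; lra.
Qed.

Lemma sublinear0 p : sublinear p -> p 0 = 0.
Proof. by move=> /sublinearZ pZ; rewrite -(scale0r (0 : X)) pZ// mul0r. Qed.

Lemma sublinearN_ge p x : sublinear p -> - p x <= p (- x).
Proof.
move=> sp; have := sp.1 x (- x); rewrite subrr sublinear0//; lra.
Qed.

(* The witness is q x = inf_(t >= 0) (p (x + t y) - t (p y)). *)
Lemma sublinear_lower p y : sublinear p ->
  exists q, [/\ sublinear q, forall x, q x <= p x & q (- y) <= - p y].
Proof.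
move=> sp; have pZ := sublinearZ sp; have [pD _] := sp.
pose S x := [set p (x + t *: y) - t * p y | t in [set t : R | 0 <= t]].
have Slb x : has_lbound (S x).
  (* t p y = p (t y) <= p (x + t y) + p (- x), so the infimum is finite. *)
  exists (- p (- x)) => _ [t /= t0 <-].
  have := pD (x + t *: y) (- x).
  rewrite addrAC subrr add0r pZ//; lra.
have Sin x t : 0 <= t -> S x (p (x + t *: y) - t * p y) by exists t.
have S0 x : S x !=set0 by exists (p (x + 0 *: y) - 0 * p y); exact: Sin.
have qle x t : 0 <= t -> inf (S x) <= p (x + t *: y) - t * p y.
  by move=> t0; apply: ge_inf => //; exact: Sin.
exists (fun x => inf (S x)); split; first split.
- move=> u v; rewrite -lerBlDr; apply: (lb_le_inf (S0 u)) => _ [s /= s0 <-].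
  rewrite lerBlDr -lerBlDl; apply: (lb_le_inf (S0 v)) => _ [t /= t0 <-].
  have := qle (u + v) (s + t) (addr_ge0 s0 t0).
  have := pD (u + s *: y) (v + t *: y).
  rewrite addrACA -scalerDl mulrDl; lra.
- move=> c x c0; rewrite -ler_pdivrMl//; apply: (lb_le_inf (S0 x)) => _ [t /= t0 <-].
  rewrite ler_pdivrMl//.
  have := qle (c *: x) (c * t) (mulr_ge0 (ltW c0) t0).
  by rewrite -scalerA -scalerDr pZ ?(ltW c0)// -mulrA mulrBr.
- by move=> x; have := qle x 0 (lexx _); rewrite scale0r addr0 mul0r subr0.
- have := qle (- y) 1 ler01.
  by rewrite scale1r addNr sublinear0// mul1r sub0r.
Qed.

(** The bound is the pointwise infimum, or p for the empty chain. Its subadditivity uses totality: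
    of the two members taken at u and at v, the smaller one serves at both points. *)
Lemma sublinear_chain p (A : set (X -> R)) : sublinear p ->
  (forall q, A q -> sublinear q /\ forall x, q x <= p x) ->
  total_on A (fun q q' => forall x, q' x <= q x) ->
  exists q, [/\ sublinear q, forall x, q x <= p x &
    forall q', A q' -> forall x, q x <= q' x].
Proof.
move=> sp Ap Atot.
have [[q0 Aq0]|/set0P/negP] := pselect (A !=set0); last first.
  by rewrite negbK => /eqP A0; exists p; split=> // q; rewrite A0.
pose S x := [set q x | q in A].
have Slb x : has_lbound (S x).
  exists (- p (- x)) => _ [q Aq <-]; have [sq qp] := Ap _ Aq.
  have := sublinearN_ge (- x) sq; rewrite opprK; have := qp (- x); lra.
have S0 x : S x !=set0 by exists (q0 x), q0.
have qle x q : A q -> inf (S x) <= q x by move=> Aq; apply: ge_inf => //; exists q.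
exists (fun x => inf (S x)); split; first split; last by move=> q Aq x; exact: qle.
- move=> u v; rewrite -lerBlDr; apply: (lb_le_inf (S0 u)) => _ [q Aq <-].
  rewrite lerBlDr -lerBlDl; apply: (lb_le_inf (S0 v)) => _ [r Ar <-].
  have [[qD _] _] := Ap _ Aq; have [[rD _] _] := Ap _ Ar.
  case: (Atot _ _ Aq Ar) => qr.
    by have := qr u; have := rD u v; have := qle (u + v) _ Ar; lra.
  by have := qr v; have := qD u v; have := qle (u + v) _ Aq; lra.
- move=> c x c0; rewrite -ler_pdivrMl//; apply: (lb_le_inf (S0 x)) => _ [q Aq <-].
  rewrite ler_pdivrMl//; have [[_ qZ] _] := Ap _ Aq.
  exact: le_trans (qle _ _ Aq) (qZ _ _ c0).
- by move=> x; apply: le_trans (qle x _ Aq0) _; have [_] := Ap _ Aq0; exact.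
Qed.

(* A pointwise minimal sublinear functional is linear: by [sublinear_lower] it
   satisfies q (- y) <= - q y for all y. *)
Lemma sublinear_dominates_linear p : sublinear p ->
  exists f : X -> R, [/\ forall x y, f (x + y) = f x + f y,
    forall (a : R) x, f (a *: x) = a * f x & forall x, f x <= p x].
Proof.
move=> sp.
pose T := {q | sublinear q /\ forall x, q x <= p x}.
(* The order is reversed: a maximal element for Zorn's lemma is a pointwise minimal functional. *)
pose le (q r : T) := `[< forall x, sval r x <= sval q x >].
have [||||q qmin] := @Zorn T le.
- by move=> q; apply/asboolP.
- move=> q r s /asboolP qr /asboolP rs; apply/asboolP => x.
  exact: le_trans (rs x) (qr x).
- move=> [q hq] [r hr] /asboolP/= qr /asboolP/= rq; apply: eq_exist => /=.
  by apply/funext => x; apply/eqP; rewrite eq_le qr rq.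
- move=> A Atot.
  have [| |q [sq qp qA]] := @sublinear_chain p (sval @` A) sp.
  + by move=> _ [[q hq] Aq <-].
  + move=> _ _ [q Aq <-] [r Ar <-].
    by case: (Atot _ _ Aq Ar) => /asboolP; [left|right].
  + exists (exist _ q (conj sq qp)) => r Ar; apply/asboolP => /= x.
    by apply: qA; exists r.
case: q qmin => q [sq qp] qmin.
have qN y : q (- y) = - q y.
  apply/eqP; rewrite eq_le sublinearN_ge// andbT.
  have [r [sr rq rN]] := sublinear_lower y sq.
  have rp x : r x <= p x by exact: le_trans (rq x) (qp x).
  have /(congr1 sval)/= rE : exist _ r (conj sr rp) = exist _ q (conj sq qp) :> T.
    by apply: qmin; apply/asboolP.
  by rewrite rE in rN.
exists q; split=> // [x y|a x].
- apply/eqP; rewrite eq_le sq.1/=.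
  by have := sq.1 (x + y) (- y); rewrite addrK qN lerBrDr.
- have [a0|a0] := leP 0 a; first exact: sublinearZ.
  by rewrite -[a]opprK scaleNr qN sublinearZ ?mulNr// oppr_ge0 ltW.
Qed.

(** Any linear f below the [q] of [sublinear_lower] satisfies - f y = f (- y) <= q (- y) <= - p
    y. *)
Lemma hahn_banach_sublinear p y : sublinear p ->
  exists f : X -> R, [/\ forall x y, f (x + y) = f x + f y,
    forall (a : R) x, f (a *: x) = a * f x,
    forall x, f x <= p x & p y <= f y].
Proof.
move=> sp; have [q [sq qp qN]] := sublinear_lower y sp.
have [f [fD fZ fq]] := sublinear_dominates_linear sq.
exists f; split=> // [x|]; first exact: le_trans (fq x) (qp x).
have := fq (- y); rewrite -scaleN1r fZ scaleN1r mulN1r.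
by move=> /le_trans/(_ qN); rewrite lerN2.
Qed.

End HahnBanach.

(** * Separation of points by the continuous dual *)

Section DualSeparates.
Context {R : realType} {X : tvsType R}.
Implicit Types (x y : X) (b : set X).

Lemma convex_setP b : convex_set b -> forall x y (t : R), 0 <= t <= 1 ->
  b x -> b y -> b (t *: x + (1 - t) *: y).
Proof.
move=> cb x y t /andP[t0 t1] bx bY.
have := cb x y (Itv01 t0 t1); rewrite !inE => /(_ bx bY).
by [].
Qed.

Lemma cvg_scaleB (k : R) x : k *: (y - x) @[y --> x] --> (0 : X).
Proof.
have : continuous (fun y : X => k *: (y - x)).
  move=> y; apply: (@continuous_comp X (R^o * X)%type X
    (fun y => (k, y - x)) (fun z => z.1 *: z.2)); last exact: scale_continuous.
  apply: (@cvg_pair _ _ _ _ (nbhs (k : R^o))); first exact: cvg_cst.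
  apply: (@continuous_comp X (X * X)%type X
    (fun y => (y, x)) (fun z => z.1 - z.2)); last exact: sub_continuous.
  by apply: cvg_pair; [exact: cvg_id | exact: cvg_cst].
by move=> /(_ x); rewrite /continuous_at subrr scaler0.
Qed.

(** A point y close to x has both e^-1 (y - x) and - e^-1 (y - x) in [b]. The two signs bound f y -
    f x by e from both sides. *)
Lemma linear_continuous_le1 (f : X -> R) b :
  (forall x y, f (x + y) = f x + f y) -> (forall (a : R) x, f (a *: x) = a * f x) ->
  nbhs (0 : X) b -> (forall x, b x -> f x <= 1) -> continuous f.
Proof.
move=> fD fZ b0 fb x; apply/cvgrPdist_le => e e0.
have P : \forall y \near x, b (e^-1 *: (y - x)) by exact: (cvg_scaleB e^-1).
have N : \forall y \near x, b (- e^-1 *: (y - x)) by exact: (cvg_scaleB (- e^-1)).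
near=> y.
have fB : f (y - x) = f y - f x by rewrite fD -scaleN1r fZ mulN1r.
rewrite distrC ler_norml; apply/andP; split.
  have : b (- e^-1 *: (y - x)) by near: y.
  by move=> /fb; rewrite fZ fB mulNr lerNl mulrC ler_pdivlMr// mulN1r.
have : b (e^-1 *: (y - x)) by near: y.
by move=> /fb; rewrite fZ fB mulrC ler_pdivrMr// mul1r.
Unshelve. all: by end_near. Qed.

(** The Minkowski functional of [b]. *)
Definition gauge b x : R := inf [set t : R | 0 < t /\ b (t^-1 *: x)].

(** Neighbourhoods of 0 are absorbing, because s x tends to 0 with s. This keeps the infimum in
    [gauge] from being that of an empty set. *)
Lemma gauge_set_neq0 b x : nbhs (0 : X) b ->
  [set t : R | 0 < t /\ b (t^-1 *: x)] !=set0.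
Proof.
move=> b0.
have : s *: x @[s --> (0 : R^o)] --> (0 : X).
  have : continuous (fun s : R^o => s *: x).
    move=> s; apply: (@continuous_comp R^o (R^o * X)%type X
      (fun s => (s, x)) (fun z => z.1 *: z.2)); last exact: scale_continuous.
    by apply: (@cvg_pair _ _ _ _ (nbhs s)); [exact: cvg_id | exact: cvg_cst].
  by move=> /(_ 0); rewrite /continuous_at scale0r.
move=> /(_ _ b0) /nbhs_ballP[e /= e0 eb].
exists (e / 2)^-1; split; first by rewrite invr_gt0 divr_gt0.
rewrite invrK; apply: eb; rewrite -ball_normE /= sub0r normrN gtr0_norm ?divr_gt0//.
by rewrite ltr_pdivrMr// mulr2n mulrDr mulr1 ltrDl.
Qed.

Lemma gauge_le b x (t : R) : 0 < t -> b (t^-1 *: x) -> gauge b x <= t.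
Proof. by move=> t0 bx; apply: ge_inf => //; exists 0 => s [/ltW]. Qed.

Lemma le_gauge b x (c : R) : nbhs (0 : X) b ->
  (forall t, 0 < t -> b (t^-1 *: x) -> c <= t) -> c <= gauge b x.
Proof.
move=> b0 ct; rewrite /gauge; apply: lb_le_inf; first exact: gauge_set_neq0.
by move=> t [t0 bx]; exact: ct.
Qed.

Lemma gauge_sublinear b : convex_set b -> nbhs (0 : X) b -> sublinear (gauge b).
Proof.
move=> cb b0; split.
- move=> x y; rewrite -lerBlDr.
  apply: le_gauge => // s s0 bx.
  rewrite lerBlDr -lerBlDl; apply: le_gauge => // t t0 bY.
  rewrite lerBlDl; have st0 := addr_gt0 s0 t0; apply: gauge_le => //.
  (* The weights s / (s + t) and t / (s + t) combine x / s and y / t into (x + y) / (s + t). *)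
  have w01 : 0 <= s / (s + t) <= 1.
    by rewrite divr_ge0 ?(ltW s0) ?(ltW st0)//= ler_pdivrMr// mul1r lerDl ltW.
  have := convex_setP cb w01 bx bY.
  rewrite !scalerA (_ : s / (s + t) / s = (s + t)^-1); last first.
    by field; rewrite !gt_eqF.
  rewrite (_ : (1 - s / (s + t)) / t = (s + t)^-1) ?scalerDr//.
  by field; rewrite !gt_eqF.
- move=> c x c0; rewrite -ler_pdivrMl//.
  apply: le_gauge => // t t0 bx.
  rewrite ler_pdivrMl//; apply: gauge_le; first exact: mulr_gt0.
  rewrite scalerA (_ : (c * t)^-1 * c = t^-1)//.
  by field; rewrite !gt_eqF.
Qed.

(** If x / t were in [b] with t < 1, then x, which is on the segment from 0 to x / t, would be in
    [b]. *)
Lemma gauge_ge1 b x : convex_set b -> nbhs (0 : X) b -> ~ b x -> 1 <= gauge b x.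
Proof.
move=> cb b0 nbx; apply: le_gauge => // t t0 bx.
rewrite leNgt; apply/negP => t1; apply: nbx.
have t01 : 0 <= t <= 1 by rewrite !ltW.
have := convex_setP cb t01 bx (nbhs_singleton b0).
by rewrite scaler0 addr0 scalerA mulfV ?scale1r// gt_eqF.
Qed.

(** A convex open neighbourhood [b] of 0 missing x - y has gauge at least 1 there. Hahn-Banach gives
    a linear f below the gauge with f (x - y) >= 1, and f <= 1 on [b] makes f continuous. *)
Lemma dual_separates : hausdorff_space X -> forall x y, x != y ->
  exists2 f : X -> R, in_dual f & f x != f y.
Proof.
rewrite open_hausdorff => hX x y xy.
have /hX[[A B] /= [xA B0] [_ oB /eqP AB0]] : x - y != 0 by rewrite subr_eq0.
have [Bs convBs [Bs_open Bs_nbhs]] := @locally_convex R X.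
have [b [Bsb b0] bB] := Bs_nbhs 0 B (open_nbhs_nbhs (conj oB (set_mem B0))).
have nb0 : nbhs 0 b by apply: open_nbhs_nbhs; split=> //; exact: Bs_open.
have cb : convex_set b by apply: convBs; rewrite inE.
have nbx : ~ b (x - y).
  move=> /bB Bx; have : (A `&` B) (x - y) by split=> //; exact: set_mem.
  by rewrite AB0.
have [f [fD fZ fp pf]] := hahn_banach_sublinear (x - y) (gauge_sublinear cb nb0).
exists f.
  split=> //; apply: (linear_continuous_le1 fD fZ nb0) => z bz.
  by apply: le_trans (fp z) _; apply: gauge_le; rewrite ?invr1 ?scale1r.
rewrite -subr_eq0 -mulN1r -fZ -fD scaleN1r gt_eqF//.
by apply: lt_le_trans pf; exact: lt_le_trans ltr01 (gauge_ge1 cb nb0 nbx).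
Qed.

End DualSeparates.

(** * Stone-Weierstrass theorem on a compact set *)

Section StoneWeierstrass.
Context {R : realType}.

(* Converges to |t| uniformly on [-1, 1]: the error d_n = |t| - abs_poly n t lies in
   [0, |t|] and satisfies d_(n+1) = d_n (1 - (2 |t| - d_n) / 2) <= d_n (1 - d_n / 2). *)
Fixpoint abs_poly (n : nat) (t : R) : R :=
  if n is k.+1 then abs_poly k t + 2^-1 * (t * t - abs_poly k t * abs_poly k t)
  else 0.

Lemma abs_poly_bounds n (t : R) : `|t| <= 1 ->
  0 <= abs_poly n t <= `|t| /\ n%:R * (`|t| - abs_poly n t) <= 2.
Proof.
move=> t1; have t0 := normr_ge0 t.
have tt : t * t = `|t| * `|t| by rewrite -!expr2 real_normK// num_real.
elim: n => [|n [/andP[p0 pt] IH]] /=; first by rewrite mul0r lexx t0.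
rewrite tt -[n.+1%:R]natr1; move: (`|t|) (abs_poly n t) (n%:R : R) (ler0n R n) t0 t1 p0 pt IH.
move=> s p k k0 s0 s1 p0 ps IH; split.
  (* The increment is (s - p)(s + p) / 2 and the new error is (s - p)(2 - s - p) / 2. *)
  have h1 : 0 <= (s - p) * (s + p) by apply: mulr_ge0; lra.
  have h2 : 0 <= (s - p) * (2 - s - p) by apply: mulr_ge0; lra.
  by apply/andP; split; lra.
have [d0 d1] : 0 <= s - p /\ s - p <= 1 by lra.
(* With d = s - p the new error is d (1 - d / 2) - d p, and 2 - (k + 1) d (1 - d / 2) = (2 - k d)(1
   - d / 2) + d^2 / 2 >= 0. *)
have h1 : 0 <= (k + 1) * (s - p) * p by rewrite !mulr_ge0//; lra.
have h2 : 0 <= (2 - k * (s - p)) * (1 - (s - p)) by apply: mulr_ge0; lra.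
have h3 : 0 <= (s - p) * (s - p) by exact: mulr_ge0.
nra.
Qed.

Lemma abs_poly_approx (e : R) : 0 < e ->
  exists n, forall t, `|t| <= 1 -> `| `|t| - abs_poly n t| <= e.
Proof.
move=> e0; exists (Num.bound (2 / e)) => t t1.
have ne : 2 / e < (Num.bound (2 / e))%:R by apply: archi_boundP; rewrite divr_ge0// ltW.
have [/andP[p0 pt] nd] := abs_poly_bounds (Num.bound (2 / e)) t1.
rewrite ger0_norm ?subr_ge0// leNgt; apply/negP => ed.
move: ne; rewrite ltr_pdivrMr// ltNge => /negP; apply.
by apply: le_trans nd; rewrite ler_wpM2l// ltW.
Qed.

Context {T : topologicalType} (C : set T).
Hypothesis cptC : compact C.

Lemma compact_within_bounded (g : T -> R) : {within C, continuous g} ->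
  exists2 M, 0 < M & forall x, C x -> `|g x| <= M.
Proof.
move=> cg; have /compact_bounded[M [_ MP]] := continuous_compact cg cptC.
exists (`|M| + 1); first by rewrite ltr_wpDl.
move=> x Cx; apply: MP; last by exists x.
by rewrite (le_lt_trans (ler_norm M))// ltrDl.
Qed.

Lemma within_near_lt (f g : T -> R) x :
  {within C, continuous f} -> {within C, continuous g} -> C x -> f x < g x ->
  \forall y \near x, C y -> f y < g y.
Proof.
move=> /subspace_continuousP cf /subspace_continuousP cg Cx fg.
have cfg : g y - f y @[y --> within C (nbhs x)] --> g x - f x.
  by apply: cvgB; [exact: cg | exact: cf].
have gf0 : 0 < g x - f x by rewrite subr_gt0.
have := cvgr_gt (g x - f x) cfg 0 gf0.
rewrite near_withinE => H; near=> y => Cy; rewrite -subr_gt0.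
by move: Cy; near: y; exact: H.
Unshelve. all: by end_near.
Qed.

(** A member above f - e at x stays so near x, and maxima glue finitely many such members. The
    family [P] is abstract so that it can also carry a bound from the other side. *)
Lemma compact_max_cover (P : set (T -> R)) (f : T -> R) (e : R) :
  {within C, continuous f} -> P !=set0 ->
  (forall g, P g -> {within C, continuous g}) ->
  (forall g h, P g -> P h -> P (g \max h)) ->
  (forall x, C x -> exists2 h, P h & f x - e < h x) ->
  exists2 h, P h & forall x, C x -> f x - e < h x.
Proof.
move=> cf [h0 Ph0] Pc Pmax Px.
(* Compactness in its near-covering form, along the tails of the family P
   directed by the pointwise order on C. *)
pose F : set_system (T -> R) := [set A | exists2 h, P h &
  forall h', P h' -> (forall x, C x -> h x <= h' x) -> A h'].
have FF : Filter F.
  split; first by exists h0.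
  - move=> A B [g Pg gA] [h Ph hB]; exists (g \max h); first exact: Pmax.
    move=> k Pk ghk; split; [apply: gA | apply: hB] => // x Cx;
      by apply: le_trans (ghk x Cx); rewrite le_max lexx ?orbT.
  - by move=> A B AB [g Pg gA]; exists g => // h Ph gh; apply: AB; exact: gA.
have /near_covering_withinP covC := (compact_near_coveringP C).1 cptC.
have [|h Ph hF] := @covC _ F (fun h x => f x - e < h x) FF.
  move=> x Cx; have [h Ph hx] := Px x Cx.
  exists ([set y | C y -> f y - e < h y],
          [set h' | P h' /\ forall x, C x -> h x <= h' x]) => /=.
    split; last by exists h => // h' Ph' hh'.
    apply: (@within_near_lt (fun y => f y - e) h) => //; last exact: Pc.
    move=> y; apply: continuousB => //; [exact: cf | exact: cst_continuous].
  move=> [y h'] /= [hy [_ hh']] Cy.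
  by apply: lt_le_trans (hy Cy) (hh' _ Cy).
by exists h => // x Cx; exact: (hF h).
Qed.

(** Negation exchanges minima and maxima, so this is [compact_max_cover] for - f and the negated
    family. *)
Lemma compact_min_cover (P : set (T -> R)) (f : T -> R) (e : R) :
  {within C, continuous f} -> P !=set0 ->
  (forall g, P g -> {within C, continuous g}) ->
  (forall g h, P g -> P h -> P (g \min h)) ->
  (forall x, C x -> exists2 h, P h & h x < f x + e) ->
  exists2 h, P h & forall x, C x -> h x < f x + e.
Proof.
move=> cf [h0 Ph0] Pc Pmin Px.
have NN (h : T -> R) : (fun x => - - h x) = h by apply/funext => x; rewrite opprK.
have cN (h : T -> R) : {within C, continuous h} -> {within C, continuous (fun x => - h x)}.
  by move=> ch x; apply: continuousN; exact: ch.
have [|||||h Ph hf] := @compact_max_cover [set h | P (fun x => - h x)]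
    (fun x => - f x) e.
- exact: cN.
- by exists (fun x => - h0 x); rewrite /= NN.
- by move=> g /Pc/cN; rewrite NN.
- move=> g h /= Pg Ph; rewrite (_ : (fun _ => _) = (fun x => - g x) \min (fun x => - h x)).
    exact: Pmin.
  by apply/funext => x /=; rewrite oppr_max.
- by move=> x Cx; have [h Ph hx] := Px x Cx; exists (fun x => - h x); rewrite /= ?NN//; lra.
by exists (fun x => - h x) => // x /hf; lra.
Qed.


Lemma continuous_within_comp (k : R -> R) (g : T -> R) :
  continuous k -> {within C, continuous g} -> {within C, continuous (fun x => k (g x))}.
Proof.
by move=> ck cg x; apply: continuous_comp; [exact: cg | exact: ck].
Qed.

Variable S : set (T -> R).
Hypothesis S_cont : forall g, S g -> {within C, continuous g}.
Hypothesis S_cst : forall a : R, S (fun=> a).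
Hypothesis S_add : forall g h, S g -> S h -> S (fun x => g x + h x).
Hypothesis S_mul : forall g h, S g -> S h -> S (fun x => g x * h x).
Hypothesis S_sep : forall x y, C x -> C y -> x != y ->
  exists2 g, S g & g x != g y.

(** The uniform closure of the algebra [S] on [C]: it is closed under absolute values, hence under
    max and min, as the cover lemmas require. *)
Definition unif_approx (f : T -> R) := {within C, continuous f} /\
  forall e : R, 0 < e -> exists2 g, S g & forall x, C x -> `|f x - g x| <= e.

Lemma unif_approx_sub g : S g -> unif_approx g.
Proof.
move=> Sg; split; first exact: S_cont.
by move=> e e0; exists g => // x _; rewrite subrr normr0 ltW.
Qed.

Lemma unif_approxD f g : unif_approx f -> unif_approx g ->
  unif_approx (fun x => f x + g x).
Proof.
move=> [cf fS] [cg gS]; split; first by move=> x; apply: continuousD; [exact: cf|exact: cg].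
move=> e e0; have e20 : 0 < e / 2 by rewrite divr_gt0.
have [f' Sf' ff'] := fS _ e20; have [g' Sg' gg'] := gS _ e20.
exists (fun x => f' x + g' x); first exact: S_add.
move=> x Cx; rewrite opprD addrACA (le_trans (ler_normD _ _))//.
by rewrite [leRHS]splitr lerD// ?ff' ?gg'.
Qed.

Lemma unif_approxZ f (a : R) : unif_approx f -> unif_approx (fun x => a * f x).
Proof.
move=> [cf fS]; split; first by apply: continuous_within_comp cf; exact: mulrl_continuous.
(* Adding 1 keeps the divisor positive when a = 0. *)
move=> e e0; have a0 : 0 < `|a| + 1 by rewrite ltr_wpDl.
have [g Sg fg] := fS (e / (`|a| + 1)) (divr_gt0 e0 a0).
exists (fun x => a * g x); first exact: S_mul.
move=> x Cx; rewrite -mulrBr normrM.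
apply: (@le_trans _ _ ((`|a| + 1) * `|f x - g x|)).
  by rewrite ler_wpM2r// lerDl.
by rewrite mulrC -ler_pdivlMr// fg.
Qed.

Lemma abs_poly_mem n g : S g -> S (fun x => abs_poly n (g x)).
Proof.
move=> Sg; elim: n => [|n IH] /=; first exact: S_cst.
apply: S_add => //; apply: (S_mul (S_cst _)); apply: S_add; first exact: S_mul.
rewrite (_ : (fun _ => _) = (fun x => -1 * (abs_poly n (g x) * abs_poly n (g x)))).
  by apply: (S_mul (S_cst _)); exact: S_mul.
by apply/funext => x; rewrite mulN1r.
Qed.

Lemma unif_approx_abs f : unif_approx f -> unif_approx (fun x => `|f x|).
Proof.
move=> [cf fS]; split; first by apply: continuous_within_comp cf; exact: norm_continuous.
move=> e e0; have e20 : 0 < e / 2 by rewrite divr_gt0.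
have [g Sg fg] := fS _ e20.
have [M M0 gM] := compact_within_bounded (S_cont Sg).
have [n np] := abs_poly_approx (divr_gt0 e20 M0).
(* M bounds |g| on [C], so g / M takes values in [-1, 1], where [abs_poly] is accurate to e / 2 /
   M. *)
exists (fun x => M * abs_poly n (M^-1 * g x)).
  by apply: (S_mul (S_cst _)); apply: abs_poly_mem; exact: (S_mul (S_cst _)).
move=> x Cx; rewrite -(subrK `|g x| `|f x|) -addrA (le_trans (ler_normD _ _))//.
rewrite [leRHS]splitr lerD//; first exact: le_trans (ler_dist_dist _ _) (fg x Cx).
have -> : `|g x| = M * `|M^-1 * g x|.
  by rewrite normrM gtr0_norm ?invr_gt0// mulrA mulfV ?mul1r// gt_eqF.
rewrite -mulrBr normrM (gtr0_norm M0) mulrC -ler_pdivlMr// np//.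
by rewrite normrM gtr0_norm ?invr_gt0// mulrC ler_pdivrMr// mul1r gM.
Qed.

Lemma unif_approxB f g : unif_approx f -> unif_approx g ->
  unif_approx (fun x => f x - g x).
Proof.
move=> af ag; rewrite (_ : (fun _ => _) = (fun x => f x + -1 * g x)).
  by apply: unif_approxD => //; exact: unif_approxZ.
by apply/funext => x; rewrite mulN1r.
Qed.

Lemma unif_approx_max f g : unif_approx f -> unif_approx g -> unif_approx (f \max g).
Proof.
move=> af ag; rewrite (_ : _ \max _ = (fun x => 2^-1 * (f x + g x + `|f x - g x|))).
  apply: unif_approxZ; apply: unif_approxD; first exact: unif_approxD.
  by apply: unif_approx_abs; exact: unif_approxB.
by apply/funext => x /=; rewrite maxr_absE mulrC.
Qed.

Lemma unif_approx_min f g : unif_approx f -> unif_approx g -> unif_approx (f \min g).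
Proof.
move=> af ag; rewrite (_ : _ \min _ = (fun x => 2^-1 * (f x + g x - `|f x - g x|))).
  apply: unif_approxZ; apply: unif_approxB; first exact: unif_approxD.
  by apply: unif_approx_abs; exact: unif_approxB.
by apply/funext => x /=; rewrite minr_absE mulrC.
Qed.

Lemma interpolation (f : T -> R) x y : C x -> C y ->
  exists2 h, S h & h x = f x /\ h y = f y.
Proof.
move=> Cx Cy; have [->|xy] := eqVneq x y; first by exists (fun=> f y).
have [s Ss sxy] := S_sep Cx Cy xy.
(* The affine function of the separating [s] with the prescribed values at x and y. *)
exists (fun z => f x + (f y - f x) / (s y - s x) * (s z + - s x)).
  apply: (S_add (S_cst _)); apply: (S_mul (S_cst _)); exact: (S_add Ss (S_cst _)).
rewrite subrr mulr0 addr0; split=> //.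
by rewrite mulfVK ?subr_eq0 1?eq_sym// addrC subrK.
Qed.

(** For fixed x, maxima of interpolants at x and y over varying y exceed f - e / 2 everywhere and
    stay below f + e / 2 at x. Minima over x then bring the function below f + e / 2 everywhere, and
    a member of [S] is taken within e / 2 of the result. *)
Theorem stone_weierstrass (f : T -> R) (e : R) : {within C, continuous f} -> 0 < e ->
  exists2 g, S g & forall x, C x -> `|f x - g x| < e.
Proof.
move=> cf e0; have e20 : 0 < e / 2 by rewrite divr_gt0.
have S0 : unif_approx (fun=> 0) by exact: unif_approx_sub (S_cst 0).
have lower x : C x -> exists2 h, unif_approx h /\ h x < f x + e / 2 &
    forall y, C y -> f y - e / 2 < h y.
  move=> Cx; apply: (@compact_max_cover
    [set h | unif_approx h /\ h x < f x + e / 2]) => //.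
  - have [h Sh [hx _]] := interpolation f Cx Cx.
    by exists h; split; [exact: unif_approx_sub | rewrite hx ltrDl].
  - by move=> g [[]].
  - move=> g h [ag gx] [ah hx]; split; first exact: unif_approx_max.
    by rewrite /= gt_max gx hx.
  - move=> y Cy; have [h Sh [hx hy]] := interpolation f Cx Cy.
    exists h; last by rewrite hy ltrBlDr ltrDl.
    by split; [exact: unif_approx_sub | rewrite hx ltrDl].
have [|||||h [[_ /(_ _ e20)[g Sg hg]] hl] hu] := @compact_min_cover
    [set h | unif_approx h /\ forall y, C y -> f y - e / 2 < h y] f (e / 2) => //.
- have [[x Cx]|C0] := pselect (C !=set0).
    by have [h [ah _] hl] := lower x Cx; exists h.
  (* With [C] empty, any function witnesses that the family is nonempty. *)
  by exists (fun=> 0); split=> // y Cy; case: C0; exists y.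
- by move=> g [[]].
- move=> g h [ag gl] [ah hl]; split; first exact: unif_approx_min.
  by move=> y Cy; rewrite /= lt_min gl// hl.
- by move=> x Cx; have [h [ah hx] hl] := lower x Cx; exists h.
exists g => // x Cx; have := hg x Cx; have := hl x Cx; have := hu x Cx.
rewrite ler_norml ltr_norml => h1 h2 /andP[h3 h4]; apply/andP; split; lra.
Qed.

End StoneWeierstrass.

(** * Linear spans of sets of functions *)

Section LinearSpan.
Context {R : realType} {T : Type}.
Implicit Types B : set (T -> R).

(** Adding one term at a time allows induction over a combination without index families. *)
Inductive linspan B : set (T -> R) :=
| linspan0 : linspan B (fun=> 0)
| linspan_cons c g h : B g -> linspan B h -> linspan B (fun x => c * g x + h x).

Lemma linspan_gen B c g : B g -> linspan B (fun x => c * g x).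
Proof.
move=> Bg; rewrite (_ : (fun _ => _) = (fun x => c * g x + 0)).
  by apply: linspan_cons => //; exact: linspan0.
by apply/funext => x; rewrite addr0.
Qed.

Lemma linspanD B g h : linspan B g -> linspan B h -> linspan B (fun x => g x + h x).
Proof.
move=> Bg Bh; elim: Bg => [|c g' g0 Bg' _ IH].
  by rewrite (_ : (fun _ => _) = h)//; apply/funext => x; rewrite add0r.
rewrite (_ : (fun _ => _) = (fun x => c * g' x + (g0 x + h x))).
  exact: linspan_cons.
by apply/funext => x; rewrite addrA.
Qed.

Lemma linspanZ B a g : linspan B g -> linspan B (fun x => a * g x).
Proof.
elim=> [|c g' h Bg' _ IH].
  by rewrite (_ : (fun _ => _) = (fun=> 0)); [exact: linspan0 | apply/funext => x; rewrite mulr0].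
rewrite (_ : (fun _ => _) = (fun x => (a * c) * g' x + a * h x)).
  exact: linspan_cons.
by apply/funext => x; rewrite mulrDr mulrA.
Qed.

Lemma linspan_sum B n (c : 'I_n -> R) (g : 'I_n -> T -> R) : (forall i, B (g i)) ->
  linspan B (fun x => \sum_(i < n) c i * g i x).
Proof.
elim: n c g => [|n IH] c g Bg.
  rewrite (_ : (fun _ => _) = (fun=> 0)); first exact: linspan0.
  by apply/funext => x; rewrite big_ord0.
rewrite (_ : (fun _ => _) = (fun x => c ord0 * g ord0 x +
    \sum_(i < n) c (lift ord0 i) * g (lift ord0 i) x)).
  by apply: linspan_cons => //; exact: IH.
by apply/funext => x; rewrite big_ord_recl.
Qed.

(** Bilinear expansion, by induction on both factors. It serves for products of exponential sums and
    for products of a sum in u with a sum in y. *)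
Lemma linspanM B1 B2 B g h :
  (forall g h, B1 g -> B2 h -> B (fun x => g x * h x)) ->
  linspan B1 g -> linspan B2 h -> linspan B (fun x => g x * h x).
Proof.
move=> BM B1g B2h; elim: B1g => [|c g' g0 Bg' _ IH].
  rewrite (_ : (fun _ => _) = (fun=> 0)); first exact: linspan0.
  by apply/funext => x; rewrite mul0r.
rewrite (_ : (fun _ => _) = (fun x => c * (g' x * h x) + g0 x * h x)); last first.
  by apply/funext => x; rewrite mulrDl mulrA.
apply: linspanD => //; apply: linspanZ; elim: B2h => [|a h' h0 Bh' _ IHh].
  rewrite (_ : (fun _ => _) = (fun=> 0)); first exact: linspan0.
  by apply/funext => x; rewrite mulr0.
rewrite (_ : (fun _ => _) = (fun x => a * (g' x * h' x) + g' x * h0 x)).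
  by apply: linspan_cons => //; exact: BM.
by apply/funext => x; rewrite mulrDr mulrCA.
Qed.

End LinearSpan.

(** * Comparison of an arbitrary norm on R^m with the coordinates *)

Section NormEquivalence.
Context {R : realType} {m : nat} (N : 'rV[R]_m -> R).
Hypothesis nN : is_norm N.

(** 0 = N 0 <= N x + N (- x) = 2 N x. *)
Lemma is_norm_ge0 x : 0 <= N x.
Proof.
have [ND NZ _] := nN.
have := ND x (- x); have := NZ (-1) x; have := NZ 0 0.
rewrite !scale0r scaleN1r subrr normr0 mul0r normrN1 mul1r => -> -> ; lra.
Qed.

Lemma is_norm_sum I (r : seq I) (F : I -> 'rV[R]_m) :
  N (\sum_(i <- r) F i) <= \sum_(i <- r) N (F i).
Proof.
have [ND NZ _] := nN; elim/big_rec2: _ => [|i x y _ h].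
  by have := NZ 0 0; rewrite scale0r normr0 mul0r => ->.
by apply: le_trans (ND _ _) _; rewrite lerD2l.
Qed.

Lemma is_norm_coord_le x :
  N x <= \sum_(j < m) `|x ord0 j| * N (delta_mx ord0 j).
Proof.
have [_ NZ _] := nN.
rewrite {1}(row_sum_delta x) (le_trans (is_norm_sum _ _))//.
by apply: ler_sum => j _; rewrite NZ.
Qed.

Lemma coord_le_mx_norm (x : 'rV[R]_m) j : `|x ord0 j| <= `|x|.
Proof.
by rewrite [leRHS]/Num.norm/= mx_normrE; apply/bigmax_geP; right; exists (ord0, j).
Qed.

Lemma is_norm_continuous : continuous N.
Proof.
have [ND NZ _] := nN.
(* The added 1 keeps the Lipschitz constant positive when m = 0. *)
pose D := \sum_(j < m) N (delta_mx ord0 j) + 1.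
have D0 : 0 < D by rewrite ltr_wpDl// sumr_ge0// => j _; exact: is_norm_ge0.
have ND' x : N x <= D * `|x|.
  apply: le_trans (is_norm_coord_le x) _; rewrite mulrDl mul1r mulr_suml ler_wpDr//.
  by apply: ler_sum => j _; rewrite mulrC ler_wpM2l ?is_norm_ge0// coord_le_mx_norm.
have NB x y : N x - N y <= N (x - y).
  by rewrite lerBlDr; have := ND (x - y) y; rewrite subrK.
move=> x A /nbhs_ballP[e /= e0 eA].
apply/nbhs_ballP; exists (e / D) => /=; first by rewrite divr_gt0.
move=> y; rewrite -ball_normE /= ltr_pdivlMr// mulrC => xy.
apply: eA; rewrite -ball_normE /=.
apply: le_lt_trans xy; rewrite ler_norml lerNl opprB; apply/andP; split.
  by apply: le_trans (NB y x) _; rewrite distrC ND'.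
exact: le_trans (NB x y) (ND' _).
Qed.

(** On the unit sphere of the max norm, which is compact, the continuous [N] has a positive minimum;
    c is its inverse, and homogeneity extends the bound. *)
Lemma is_norm_coord_ge : exists2 c : R, 0 < c &
  forall (x : 'rV[R]_m) j, `|x ord0 j| <= c * N x.
Proof.
have [_ NZ N0] := nN.
pose S := [set x : 'rV[R]_m | `|x| = 1].
have xS x : x != 0 -> S (`|x|^-1 *: x).
  by move=> x0; rewrite /S /= normrZ normfV normr_id mulVf// normr_eq0.
suff [c c0 Sc] : exists2 c : R, 0 < c & forall x, S x -> 1 <= c * N x.
  exists c => // x j; apply: le_trans (coord_le_mx_norm x j) _.
  have [->|x0] := eqVneq x 0; first by rewrite normr0 mulr_ge0 ?is_norm_ge0// ltW.
  have := Sc _ (xS _ x0); rewrite NZ normfV normr_id mulrCA mulrC ler_pdivlMr ?normr_gt0//.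
  by rewrite mul1r.
have [S0|S0] := pselect (S !=set0); last first.
  (* The sphere is empty when m = 0. *)
  by exists 1 => // x Sx; case: S0; exists x.
have cS : compact S.
  apply: bounded_closed_compact.
    exists 1; split; first exact: num_real.
    by move=> M M1 x /= ->; exact: ltW.
  apply: (@closed_comp _ _ (fun x : 'rV[R]_m => `|x|) [set 1]); last exact: closed_eq.
  by move=> x _; exact: norm_continuous.
have [x /set_mem Sx xmin] := compact_EVT_min S0 cS (continuous_subspaceT is_norm_continuous).
have Nx : 0 < N x.
  rewrite lt_neqAle is_norm_ge0 andbT eq_sym; apply/eqP => /N0 x0.
  by move: Sx; rewrite /S /= x0 normr0 => /esym/eqP; rewrite oner_eq0.
exists (N x)^-1; first by rewrite invr_gt0.
by move=> y Sy; rewrite mulrC ler_pdivlMr// mul1r; apply: xmin; rewrite inE.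
Qed.

End NormEquivalence.

(** * Linear functionals on R^d *)

Section Ridge.
Context {R : realType} {d : nat}.
Implicit Types w y : 'rV[R]_d.

Lemma dotrDl w w' y : dotr (w + w') y = dotr w y + dotr w' y.
Proof. by rewrite /dotr -big_split; apply: eq_bigr => i _; rewrite mxE mulrDl. Qed.

Lemma dotrZl (a : R) w y : dotr (a *: w) y = a * dotr w y.
Proof. by rewrite /dotr mulr_sumr; apply: eq_bigr => i _; rewrite mxE mulrA. Qed.

Lemma dotr0l y : dotr 0 y = 0.
Proof. by rewrite /dotr big1// => i _; rewrite mxE mul0r. Qed.

Lemma dotr_delta j y : dotr (delta_mx ord0 j) y = y ord0 j.
Proof.
rewrite /dotr (bigD1 j)//= mxE !eqxx mul1r big1 ?addr0// => i ij.
by rewrite mxE (negbTE ij) andbF mul0r.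
Qed.

Lemma dotr_continuous w : continuous (dotr w : 'rV[R]_d -> R).
Proof.
rewrite /dotr; apply: continuous_big => [|i _ y]; first exact: add_continuous.
apply: (@continuous_comp _ _ _ (fun y : 'rV[R]_d => y ord0 i) ( *%R (w ord0 i))).
  exact: coord_continuous.
exact: mulrl_continuous.
Qed.

End Ridge.

(** * The continuous dual as a vector space *)

Section Dual.
Context {R : realType} {X : tvsType R}.

Lemma in_dual0 : in_dual (fun _ : X => 0 : R).
Proof.
split=> [x y|a x|]; rewrite ?addr0 ?mulr0//; exact: cst_continuous.
Qed.

Lemma in_dualD (f g : X -> R) : in_dual f -> in_dual g -> in_dual (fun x => f x + g x).
Proof.
move=> [fD fZ cf] [gD gZ cg]; split=> [x y|a x|x].
- by rewrite fD gD addrACA.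
- by rewrite fZ gZ mulrDr.
- by apply: cvgD; [exact: cf | exact: cg].
Qed.

Lemma in_dualZ (a : R) (f : X -> R) : in_dual f -> in_dual (fun x => a * f x).
Proof.
move=> [fD fZ cf]; split=> [x y|b x|x].
- by rewrite fD mulrDr.
- by rewrite fZ mulrCA.
- by apply: cvgM; [exact: cvg_cst | exact: cf].
Qed.

End Dual.

(** * Density of products of neurons and ridge functions in C(V x K) *)

Section Approximation.
Context {R : realType} {X : tvsType R} {d : nat}.
Local Notation Y := 'rV[R]_d.
Variables (V : set X) (K : set Y) (sigma : R -> R).
Hypotheses (hX : hausdorff_space X) (cV : compact V) (cK : compact K).
Hypothesis TW : tauber_wiener sigma.

Definition exp_ridge : set (X * Y -> R) := [set g | exists2 f, in_dual f &
  exists w, g = fun p => expR (f p.1 + dotr w p.2)].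

(** Signs follow the final statement: thresholds are subtracted as in [topo_nn], and zeta is added
    in the ridge function. *)
Definition nn_ridge : set (X * Y -> R) := [set g | exists2 f, in_dual f &
  exists theta w zeta, g = fun p => sigma (f p.1 - theta) * sigma (dotr w p.2 + zeta)].

Lemma exp_ridge_continuous g : linspan exp_ridge g -> continuous g.
Proof.
elim=> [|c g' h [f [_ _ cf] [w ->]] _ IH] p; first exact: cst_continuous.
apply: cvgD; last exact: IH.
apply: cvgM; first exact: cvg_cst.
apply: (@continuous_comp _ _ _ (fun p : X * Y => f p.1 + dotr w p.2) expR);
  last exact: continuous_expR.
apply: cvgD.
  by apply: (@continuous_comp _ _ _ (fst : X * Y -> X) f); [exact: cvg_fst | exact: cf].
by apply: (@continuous_comp _ _ _ (snd : X * Y -> Y) (dotr w));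
  [exact: cvg_snd | exact: dotr_continuous].
Qed.

Lemma exp_ridge_cst (a : R) : linspan exp_ridge (fun=> a).
Proof.
rewrite (_ : (fun=> a) = (fun p : X * Y => a * expR (0 + dotr 0 p.2))).
  apply: linspan_gen; exists (fun=> 0); first exact: in_dual0.
  by exists 0.
by apply/funext => p; rewrite dotr0l addr0 expR0 mulr1.
Qed.

Lemma exp_ridgeM g h : linspan exp_ridge g -> linspan exp_ridge h ->
  linspan exp_ridge (fun p => g p * h p).
Proof.
apply: linspanM => _ _ [f f_dual [w ->]] [f' f'_dual [w' ->]].
exists (fun x => f x + f' x); first exact: in_dualD.
by exists (w + w'); apply/funext => p; rewrite -expRD dotrDl addrACA.
Qed.

(** If the first components differ, a dual functional with w = 0 separates; otherwise some
    coordinate of the second does, with f = 0. Injectivity of exp transfers this to the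
    exponentials. *)
Lemma exp_ridge_separates (p q : X * Y) : p != q ->
  exists2 g, linspan exp_ridge g & g p != g q.
Proof.
have gen f w : in_dual f -> linspan exp_ridge (fun p => 1 * expR (f p.1 + dotr w p.2)).
  by move=> df; apply: linspan_gen; exists f => //; exists w.
case: p q => [u y] [v z] uvyz; have [uv|uv] := eqVneq u v.
  have /rV0Pn[j] : y - z != 0.
    by rewrite subr_eq0; apply: contraNneq uvyz => ->; rewrite uv.
  rewrite !mxE subr_eq0 => yzj; exists (fun p => 1 * expR (0 + dotr (delta_mx ord0 j) p.2)).
    exact: (gen (fun=> 0) _ in_dual0).
  by rewrite /= !dotr_delta !mul1r !add0r (inj_eq (@expR_inj R)).
have [f df fuv] := dual_separates hX uv.
exists (fun p => 1 * expR (f p.1 + dotr 0 p.2)); first exact: gen.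
by rewrite /= !dotr0l !mul1r !addr0 (inj_eq (@expR_inj R)).
Qed.

Lemma exp_dense (F : X * Y -> R) (e : R) : {within V `*` K, continuous F} -> 0 < e ->
  exists2 g, linspan exp_ridge g & forall p, V p.1 -> K p.2 -> `|F p - g p| < e.
Proof.
move=> cF e0; have [|||||g Sg Fg] :=
  @stone_weierstrass R _ _ (compact_setX cV cK) (linspan exp_ridge) _ _ _ _ _ F e cF e0.
- by move=> g /exp_ridge_continuous cg; exact: continuous_subspaceT.
- exact: exp_ridge_cst.
- by move=> g h; exact: linspanD.
- by move=> g h; exact: exp_ridgeM.
- by move=> p q _ _; exact: exp_ridge_separates.
by exists g => // p Vp Kp; exact: Fg.
Qed.

(** The values of f on [C] lie in some [-M, M], so it is enough to approximate exp there and
    substitute f. It applies to dual functionals on [V] and to w . y on [K]. *)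
Lemma tauber_wiener_expR (T : topologicalType) (C : set T) (f : T -> R) (e : R) :
  compact C -> continuous f -> 0 < e ->
  exists n, exists c w th : 'I_n -> R, forall x, C x ->
    `|expR (f x) - \sum_(i < n) c i * sigma (w i * f x - th i)| < e.
Proof.
move=> cC cf e0.
have [M M0 fM] := compact_within_bounded cC (continuous_subspaceT cf).
have cexp : {within `[- M, M], continuous (@expR R)}.
  exact/continuous_subspaceT/continuous_expR.
have [n [c [w [th h]]]] := TW cexp e0.
by exists n, c, w, th => x Cx; apply: h; rewrite -ler_norml fM.
Qed.

(** a b - p q = a (b - q) + (a - p) q, with |q| <= B + e <= B + 1. *)
Lemma approx_mul (a b p q A B : R) (e : R) : 0 <= e -> e <= 1 ->
  `|a| <= A -> `|b| <= B -> `|a - p| < e -> `|b - q| < e ->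
  `|a * b - p * q| <= e * (A + B + 1).
Proof.
move=> e0 e1 aA bB ap bq.
rewrite (_ : a * b - p * q = a * (b - q) + (a - p) * (b - (b - q))); last by ring.
rewrite (le_trans (ler_normD _ _))// !normrM.
have := ler_normB b (b - q).
have := normr_ge0 a; have := normr_ge0 b; have := normr_ge0 (a - p).
have := normr_ge0 (b - q); have := normr_ge0 (b - (b - q)).
move: (`|b - (b - q)|) (`|b - q|) (`|a - p|) (`|b|) (`|a|) aA bB ap bq.
move=> r s t u v vA uB te se r0 s0 t0 u0 v0 rus.
have h1 : v * s <= A * e by apply: ler_pM => //; lra.
have h2 : t * r <= e * (B + 1) by apply: ler_pM => //; lra.
lra.
Qed.

Lemma exp_ridge_approx g (e : R) : exp_ridge g -> 0 < e ->
  exists2 h, linspan nn_ridge h & forall p, V p.1 -> K p.2 -> `|g p - h p| <= e.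
Proof.
move=> [f df [w ->]] e0; have [_ _ cf] := df.
have cef : continuous (fun x => expR (f x)).
  by move=> x; apply: continuous_comp; [exact: cf | exact: continuous_expR].
have cew : continuous (fun y => expR (dotr w y)).
  by move=> y; apply: continuous_comp; [exact: dotr_continuous | exact: continuous_expR].
have [A A0 fA] := compact_within_bounded cV (continuous_subspaceT cef).
have [B B0 wB] := compact_within_bounded cK (continuous_subspaceT cew).
have D0 : 0 < A + B + 1 by lra.
(* r <= 1 is a condition of [approx_mul], whose bound r (A + B + 1) is then at most e. *)
pose r := Num.min 1 (e / (A + B + 1)).
have r0 : 0 < r by rewrite lt_min ltr01 divr_gt0.
have [n [c [a [th fP]]]] := tauber_wiener_expR cV cf r0.
have [n' [c' [a' [th' wP]]]] := tauber_wiener_expR cK (@dotr_continuous R d w) r0.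
exists (fun p => (\sum_(i < n) c i * sigma (a i * f p.1 - th i)) *
                 (\sum_(i < n') c' i * sigma (a' i * dotr w p.2 - th' i))).
  apply: (@linspanM _ _
    [set g | exists2 f, in_dual f & exists theta, g = fun p => sigma (f p.1 - theta)]
    [set g | exists w zeta, g = fun p => sigma (dotr w p.2 + zeta)]).
  - move=> _ _ [f' df' [t ->]] [w' [z ->]].
    by exists f' => //; exists t, w', z.
  (* Dilations are absorbed into the functionals, a_i f staying in the dual and a'_i w being a
     vector; the threshold th' becomes zeta = - th'. *)
  - apply: (@linspan_sum _ _ _ _ _ (fun i p => sigma (a i * f p.1 - th i))) => i.
    by exists (fun x => a i * f x); [exact: in_dualZ | exists (th i)].
  - apply: (@linspan_sum _ _ _ _ _ (fun i p => sigma (a' i * dotr w p.2 - th' i))) => i.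
    by exists (a' i *: w), (- th' i); apply/funext => p; rewrite dotrZl.
move=> p Vp Kp; rewrite expRD.
have r1 : r <= 1 by rewrite ge_min lexx.
apply: le_trans (approx_mul (ltW r0) r1 (fA _ Vp) (wB _ Kp) (fP _ Vp) (wP _ Kp)) _.
by rewrite -ler_pdivlMr// ge_min lexx orbT.
Qed.

(** The induction keeps e general: half goes to the first term, scaled by its coefficient, and half
    to the remaining sum. *)
Lemma linspan_exp_ridge_approx g (e : R) : linspan exp_ridge g -> 0 < e ->
  exists2 h, linspan nn_ridge h & forall p, V p.1 -> K p.2 -> `|g p - h p| <= e.
Proof.
move=> Sg; elim: Sg e => [|c g' g0 Bg' _ IH] e e0.
  by exists (fun=> 0) => [|p _ _]; [exact: linspan0 | rewrite subrr normr0 ltW].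
have e20 : 0 < e / 2 by rewrite divr_gt0.
have c0 : 0 < `|c| + 1 by rewrite ltr_wpDl.
have [h Sh gh] := IH _ e20.
have [h' Sh' gh'] := exp_ridge_approx Bg' (divr_gt0 e20 c0).
exists (fun p => c * h' p + h p); first by apply: linspanD => //; exact: linspanZ.
move=> p Vp Kp; rewrite opprD addrACA -mulrBr (le_trans (ler_normD _ _))//.
rewrite [leRHS]splitr lerD ?gh// normrM.
apply: (@le_trans _ _ ((`|c| + 1) * `|g' p - h' p|)); first by rewrite ler_wpM2r// lerDl.
by rewrite mulrC -ler_pdivlMr// gh'.
Qed.

Lemma nn_ridge_dense (F : X * Y -> R) (e : R) : {within V `*` K, continuous F} -> 0 < e ->
  exists2 g, linspan nn_ridge g & forall p, V p.1 -> K p.2 -> `|F p - g p| <= e.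
Proof.
move=> cF e0; have e20 : 0 < e / 2 by rewrite divr_gt0.
have [g Sg Fg] := exp_dense cF e20.
have [h Sh gh] := linspan_exp_ridge_approx Sg e20.
exists h => // p Vp Kp; rewrite -(subrK (g p) (F p)) -addrA (le_trans (ler_normD _ _))//.
by rewrite [leRHS]splitr lerD ?gh// ltW ?Fg.
Qed.

End Approximation.

(** * Assembling the products into networks and ridge functions *)

Section Networks.
Context {R : realType} {X : tvsType R} {d m : nat}.
Local Notation Y := 'rV[R]_d.
Variable sigma : R -> R.

Definition nn_operator (H : X -> Y -> 'rV[R]_m) := exists N : nat, (0 < N)%N /\
  exists (omega : 'I_N -> Y) (zeta : 'I_N -> R) (a : 'I_N -> X -> 'rV[R]_m),
    (forall k, topo_nn sigma (a k)) /\
    forall u y, H u y = \sum_(k < N) sigma (dotr (omega k) y + zeta k) *: a k u.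

Lemma topo_nn_neuron (f : X -> R) (theta : R) (v : 'rV[R]_m) : in_dual f ->
  topo_nn sigma (fun u => sigma (f u - theta) *: v).
Proof.
move=> df; exists 1; split=> //.
exists (fun=> f), (fun=> theta), (\matrix_(j, i) v ord0 j); split=> // u.
by apply/rowP => j; rewrite !mxE big_ord1 mxE mulrC.
Qed.

Lemma nn_operator0 : nn_operator (fun _ _ => 0).
Proof.
(* At least one term is required, so zero is written with a single network whose output weights
   vanish. *)
exists 1; split=> //; exists (fun=> 0), (fun=> 0), (fun _ u => sigma (0 - 0) *: 0).
split=> [_|u y]; last by rewrite big_ord1 !scaler0.
by apply: (@topo_nn_neuron (fun=> 0)); exact: in_dual0.
Qed.

Lemma nn_operator_cons (H : X -> Y -> 'rV[R]_m) (b : X -> 'rV[R]_m) w z :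
  topo_nn sigma b -> nn_operator H ->
  nn_operator (fun u y => sigma (dotr w y + z) *: b u + H u y).
Proof.
move=> nb [N [_ [omega [zeta [a [na HE]]]]]]; exists N.+1; split=> //.
(* Index 0 receives the new term, and the old ones are shifted by one. *)
pose ext T (t0 : T) (t : 'I_N -> T) (k : 'I_N.+1) := oapp t t0 (unlift ord0 k).
exists (ext _ w omega), (ext _ z zeta), (ext _ b a); split=> [k|u y].
  by rewrite /ext; case: unliftP => [j|] _ /=.
rewrite big_ord_recl /ext unlift_none /= HE; congr (_ + _).
by apply: eq_bigr => k _; rewrite liftK.
Qed.

(** Each term c sigma(f u - theta) sigma(w . y + zeta) v becomes one summand: its ridge function is
    the factor in y, and its network is one hidden neuron with output vector c v. *)
Lemma nn_operatorD (g : X * Y -> R) (v : 'rV[R]_m) (H : X -> Y -> 'rV[R]_m) :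
  linspan (nn_ridge sigma) g -> nn_operator H ->
  nn_operator (fun u y => g (u, y) *: v + H u y).
Proof.
move=> Bg nH; elim: Bg => [|c g' g0 [f df [th [w [z ->]]]] _ IH].
  rewrite (_ : (fun _ _ => _) = H)//.
  by apply/funext => u; apply/funext => y; rewrite scale0r add0r.
have := nn_operator_cons w z (topo_nn_neuron th (c *: v) df) IH.
congr nn_operator; apply/funext => u; apply/funext => y /=.
by rewrite scalerDl addrA !scalerA; congr (_ *: _ + _ + _); ring.
Qed.

Lemma nn_operator_row (g : 'I_m -> X * Y -> R) :
  (forall j, linspan (nn_ridge sigma) (g j)) ->
  nn_operator (fun u y => \row_j g j (u, y)).
Proof.
move=> Bg.
have nr (r : seq 'I_m) :
    nn_operator (fun u y => \sum_(j <- r) g j (u, y) *: delta_mx ord0 j).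
  elim: r => [|j r IH].
    have := nn_operator0; congr nn_operator.
    by apply/funext => u; apply/funext => y; rewrite big_nil.
  have := nn_operatorD (delta_mx ord0 j) (Bg j) IH; congr nn_operator.
  by apply/funext => u; apply/funext => y; rewrite big_cons.
have := nr (index_enum _); congr nn_operator.
apply/funext => u; apply/funext => y; rewrite [RHS]row_sum_delta.
by apply: eq_bigr => j _; rewrite mxE.
Qed.

End Networks.

(** * Joint continuity on V x K and the final estimate *)

Lemma uncurry_coord_continuous (R : realType) (X Y : topologicalType) (m : nat)
    (V : set X) (K : set Y) (N : 'rV[R]_m -> R) (G : X -> Y -> 'rV[R]_m) (j : 'I_m) :
  is_norm N -> (forall u, V u -> {within K, continuous (G u)}) ->
  (forall u, V u -> forall e : R, 0 < e ->
     exists U : set X, nbhs u U /\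
       forall v, V v -> U v -> forall y, K y -> N (G v y - G u y) < e) ->
  {within V `*` K, continuous (fun p => G p.1 p.2 ord0 j)}.
Proof.
move=> nN cGu cG; apply/subspace_continuousP => -[u y] [/= Vu Ky].
have [c c0 cN] := is_norm_coord_ge nN.
apply/cvgrPdist_lt => e e0; have e20 : 0 < e / 2 by rewrite divr_gt0.
(* Coordinates are at most c N, so G v and G u differ by less than e / 2 in coordinate j, uniformly
   on [K]. Uniformity allows moving y first, with u fixed, and then u. *)
have [U [nU UG]] := cG u Vu _ (divr_gt0 e20 c0).
have /subspace_continuousP/(_ y Ky) cy : {within K, continuous (fun z => G u z ord0 j)}.
  move=> z; apply: (@continuous_comp _ _ _ (G u : subspace K -> _)
    (fun M : 'rV[R]_m => M ord0 j)); first exact: (cGu u Vu z).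
  exact: coord_continuous.
have /cvgrPdist_lt/(_ _ e20) := cy; rewrite near_withinE => nW.
rewrite near_withinE.
exists (U, [set z | K z -> `|G u y ord0 j - G u z ord0 j| < e / 2]) => //=.
move=> [v z] /= [Uv Wz] [Vv Kz].
change (`|G u y ord0 j - G v z ord0 j| < e).
rewrite -(subrK (G u z ord0 j) (G u y ord0 j)) -addrA (le_lt_trans (ler_normD _ _))//.
rewrite [ltRHS]splitr ltrD ?Wz// distrC.
have := cN (G v z - G u z) j; rewrite !mxE => /le_lt_trans; apply.
by rewrite mulrC -ltr_pdivlMr// UG.
Qed.

Unset Implicit Arguments. Set Strict Implicit.

Theorem mainTheorem2 (R : realType) (X : tvsType R) (d m : nat)
  (V : set X) (K : set 'rV[R]_d) (normm : 'rV[R]_m -> R)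
  (G : X -> 'rV[R]_d -> 'rV[R]_m) (sigma : R -> R) :
  hausdorff_space X ->
  compact V -> compact K -> (0 < m)%N ->
  is_norm normm ->
  (* G u belongs to C(K; R^m) for u in V *)
  (forall u, V u -> {within K, continuous (G u)}) ->
  (* G : V -> C(K; R^m) is continuous for the uniform norm on K *)
  (forall u, V u -> forall e : R, 0 < e ->
     exists U : set X, nbhs u U /\
       forall v, V v -> U v -> forall y, K y -> normm (G v y - G u y) < e) ->
  continuous sigma -> tauber_wiener sigma ->
  forall eps : R, 0 < eps ->
  exists N : nat, (0 < N)%N /\
  exists (omega : 'I_N -> 'rV[R]_d) (zeta : 'I_N -> R) (a : 'I_N -> X -> 'rV[R]_m),
    (forall k, topo_nn sigma (a k)) /\
    exists2 c : R, c < eps &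
      forall u y, V u -> K y ->
        normm (G u y - \sum_(k < N) sigma (dotr (omega k) y + zeta k) *: a k u) <= c.
Proof.
move=> hX cV cK _ nN cGu cG _ TW eps eps0.
(* D dominates the constant of [is_norm_coord_le], so coordinate errors of eps / 2 / D give an error
   of at most eps / 2 in [normm]. *)
pose D := \sum_(j < m) normm (delta_mx ord0 j) + 1.
have D0 : 0 < D by rewrite ltr_wpDl// sumr_ge0// => j _; exact: is_norm_ge0.
have e0 : 0 < eps / 2 / D by rewrite !divr_gt0.
have /choice[g gP] : forall j, exists g : X * 'rV[R]_d -> R,
    linspan (nn_ridge sigma) g /\
    forall p, V p.1 -> K p.2 -> `|G p.1 p.2 ord0 j - g p| <= eps / 2 / D.
  move=> j; have cGj := uncurry_coord_continuous (j := j) nN cGu cG.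
  by have [g Sg Gg] := nn_ridge_dense hX cV cK TW cGj e0; exists g.
have [N [N0 [omega [zeta [a [na HE]]]]]] := nn_operator_row (fun j => (gP j).1).
exists N; split=> //; exists omega, zeta, a; split=> //.
(* Half of eps leaves the supremum strictly below eps. *)
exists (eps / 2); first by rewrite ltr_pdivrMr// mulr2n mulrDr mulr1 ltrDl.
move=> u y Vu Ky; rewrite -HE; apply: le_trans (is_norm_coord_le nN _) _.
apply: (@le_trans _ _ (\sum_(j < m) eps / 2 / D * normm (delta_mx ord0 j))).
  apply: ler_sum => j _; rewrite ler_wpM2r ?is_norm_ge0// !mxE.
  exact: (gP j).2 (u, y) Vu Ky.
rewrite -mulr_sumr -[leRHS](divfK (lt0r_neq0 D0)) ler_wpM2l ?(ltW e0)//.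
by rewrite lerDl.
Qed.
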